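(* Let $a\ge 3$ be an integer and $f=f_a$. If $t$ is an essential turning point of $f$, then $T:=f(t)+1$ is the next essential turning point of $f$ (i.e. the smallest essential turning point greater than $t$), and there are no turning points of $f$ in the open interval $(t,T)$.
   Context: $\mathbb N=\{1,2,3,\dots\}$. For $a\in\mathbb N$, the function $f_a:\mathbb N\to\mathbb N$ is defined recursively by $f_a(1)=1$, $f_a(2)=a$, and, for each $n\ge 3$, $f_a(n)$ is the smallest positive integer that is not in $\{f_a(1),\dots,f_a(n-1)\}$ and is coprime with $f_a(n-1)$. Write $f=f_a$. A turning point of $f$ is a natural number $t$ such that either (i) $t>3$ and $f(t)-f(t-1)>1$, or (ii) $t=3$ and $f(3)\neq\min(\mathbb N\setminus\{1,a\})$. An essential turning point (ETP) of $f$ is a turning point $t$ such that, in addition: (i) $t>a$ and $f(t)\ne t$; (ii) $f(t-1)=t-2$; (iii) $\{1,2,\dots,t-1\}=\{f(1),f(2),\dots,f(t-1)\}$. *)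

(* Defs.v *)
From mathcomp Require Import all_boot.

Set Implicit Arguments.
Unset Strict Implicit.
Unset Printing Implicit Defensive.

Definition is_least (P : nat -> Prop) (m : nat) : Prop :=
  P m /\ forall k, P k -> m <= k.

Definition admissible (s : seq nat) (m : nat) : bool :=
  [&& 0 < m, m \notin s & coprime m (last 1 s)].

(* The least admissible [m]: [find] returns an index in [iota 0 _], which is
   the value itself. For [last 1 s > 0] the number 1 + last 1 s * sumn s is
   admissible, so the search succeeds ([next_termP]). *)
Definition next_term (s : seq nat) : nat :=
  find (admissible s) (iota 0 (last 1 s * sumn s).+2).

Fixpoint prefix_seq (a n : nat) : seq nat :=
  match n with
  | 0 => [::]
  | 1 => [:: 1]
  | 2 => [:: 1; a]
  | m.+1 => let s := prefix_seq a m in rcons s (next_term s)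
  end.

(* Indices are 1-based; the value at 0 is never used. *)
Definition fseq (a n : nat) : nat := last 0 (prefix_seq a n).

(* Truncated subtraction is harmless under the bound 1 < _. *)
Definition turning_point (a t : nat) : Prop :=
  (3 < t /\ 1 < fseq a t - fseq a t.-1)
  \/ (t = 3
      /\ ~ is_least (fun m => [/\ 0 < m, m <> 1 & m <> a]) (fseq a 3)).

Definition ETP (a t : nat) : Prop :=
  [/\ turning_point a t,
      a < t /\ fseq a t <> t,
      fseq a t.-1 = t.-2
    & iota 1 t.-1 =i [seq fseq a i | i <- iota 1 t.-1]].

Lemma fseq1 a : fseq a 1 = 1. Proof. by []. Qed.

Lemma fseq2 a : fseq a 2 = a. Proof. by []. Qed.

Lemma prefix_seqS a n :
  2 <= n -> prefix_seq a n.+1 = rcons (prefix_seq a n) (next_term (prefix_seq a n)).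
Proof. by case: n => [|[|n]]. Qed.

Lemma prefix_seqE a n : prefix_seq a n = [seq fseq a i | i <- iota 1 n].
Proof.
elim: n => [|n IHn] //.
have -> : prefix_seq a n.+1 = rcons (prefix_seq a n) (fseq a n.+1).
  case: n {IHn} => [|[|n]] //.
  by rewrite /fseq prefix_seqS // last_rcons.
by rewrite IHn -(addn1 n) iotaD map_cat /= cats1 (addnC n).
Qed.

Lemma next_termP s :
  0 < last 1 s -> is_least (fun m => admissible s m) (next_term s).
Proof.
move=> x0; rewrite /next_term; set x := last 1 s in x0 *; set B := (x * sumn s).+2.
have adm : admissible s (x * sumn s).+1.
  rewrite /admissible ltn0Sn /= -/x; apply/andP; split.
    apply/negP => /(nthP 0)[i ilt e].
    have : nth 0 s i <= sumn s by rewrite sumnE (big_nth 0) big_mkord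
      (bigD1 (Ordinal ilt)) //= leq_addr.
    by rewrite e ltnNge leq_pmull.
  by rewrite /coprime -addn1 mulnC gcdnC gcdnMDl gcdn1.
have hasP : has (admissible s) (iota 0 B).
  by apply/hasP; exists (x * sumn s).+1 => //; rewrite mem_iota /= add0n.
split.
  have := nth_find 0 hasP; rewrite nth_iota ?add0n //.
  by move: hasP; rewrite has_find size_iota.
move=> k Pk; rewrite leqNgt; apply/negP => lt.
have := before_find 0 lt; rewrite nth_iota ?add0n ?Pk //.
by apply: ltn_trans lt _; move: hasP; rewrite has_find size_iota.
Qed.

Lemma fseq_next a n : 2 <= n -> fseq a n.+1 = next_term (prefix_seq a n).
Proof. by move=> n2; rewrite /fseq prefix_seqS // last_rcons. Qed.

Lemma last_prefix_seq a n : 0 < n -> last 1 (prefix_seq a n) = fseq a n.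
Proof.
rewrite /fseq; case E: (prefix_seq a n) => [|y s] // n0.
by move: (congr1 size E) n0; rewrite prefix_seqE size_map size_iota /= => ->.
Qed.

Lemma fseq_gt0 a n : 0 < a -> 0 < n -> 0 < fseq a n.
Proof.
move=> a0; elim: n => [|[|[|n]] IHn] // _.
by rewrite fseq_next.
Qed.

Theorem fseq_least a n : 0 < a -> 3 <= n ->
  is_least (fun m => [/\ 0 < m,
                         forall i, 1 <= i < n -> m <> fseq a i
                       & coprime m (fseq a n.-1)])
           (fseq a n).
Proof.
case: n => [|n] // a0; rewrite ltnS /= => n2; have n0 := ltnW n2.
have : 0 < last 1 (prefix_seq a n) by rewrite last_prefix_seq // fseq_gt0.
move=> /next_termP; rewrite -fseq_next //.
have eqv m : admissible (prefix_seq a n) m <->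
  [/\ 0 < m, forall i, 1 <= i < n.+1 -> m <> fseq a i & coprime m (fseq a n)].
  rewrite /admissible last_prefix_seq // prefix_seqE.
  split=> [/and3P[m0 mN mc]|[m0 mN mc]].
    split=> // i hi e; move/negP: mN; apply; rewrite e; apply: map_f.
    by rewrite mem_iota add1n.
  apply/and3P; split=> //; apply/mapP=> -[i]; rewrite mem_iota add1n => hi e.
  exact: mN hi e.
by case=> h1 h2; split; [apply/eqv | move=> k /eqv /h2].
Qed.

(* Main.v *)
Require Import Defs.
From mathcomp Require Import all_boot.
From mathcomp Require Import zify.

Set Implicit Arguments.
Unset Strict Implicit.

(** Put [m = t - 2], so that [f (t - 1) = m] and the values used before time [t]
    are exactly [1, ..., m + 1].  The value [m + 2] is rejected at time [t], which
    forces [m] to be even.  Hence [f t = m + k], where [k] is the least integer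
    [>= 2] coprime to [m], and [k] is odd and at least [3]
    ([fseq_after_segment], [coprime_add2]).

    The jump leaves the gap [m + 2, ..., m + k - 1].  Its bottom [m + 2] is coprime
    to [m + k]: a common prime [q] divides [k - 2], so [q < k], so [q] divides [m]
    by minimality of [k], so [q] divides [k], contradicting coprimality of [k] and
    [m] ([coprime_gap_bottom]).  The sequence therefore falls to the bottom of the
    gap and then climbs by steps of one, consecutive integers being coprime, until
    the gap is full ([fill_gap]); no turning point occurs on the way.  The gap is
    full at time [m + k = T - 1], with last value [T - 2].  Since [T = m + k + 1] and
    [T - 2] are both even, [T] is rejected at time [T], so [f T > T] and [T] is again
    an essential turning point. *)

Definition visited (a n : nat) : seq nat := [seq fseq a i | i <- iota 1 n].

Lemma visitedS a n v :
  (v \in visited a n.+1) = (v \in visited a n) || (v == fseq a n.+1).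
Proof. by rewrite /visited -{1}(addn1 n) iotaD map_cat mem_cat /= inE add1n. Qed.

(** The recursion for [fseq] with the used values collected in one sequence, so
    that a description of [visited] can be rewritten into it. *)
Lemma fseq_least_visited a n : 0 < a -> 1 < n ->
  [/\ 0 < fseq a n.+1, fseq a n.+1 \notin visited a n,
      coprime (fseq a n.+1) (fseq a n)
    & forall v, 0 < v -> v \notin visited a n -> coprime v (fseq a n) ->
        fseq a n.+1 <= v].
Proof.
move=> a0 n1; have [[f0 fN fC] fmin] := @fseq_least a n.+1 a0 n1.
split=> //.
  by apply/mapP => -[i]; rewrite mem_iota add1n => /fN.
move=> v v0 vN vC; apply: fmin; split=> // i hi vE.
by case/negP: vN; rewrite vE; apply: map_f; rewrite mem_iota add1n.
Qed.

(** After [n] terms that exhaust [1, ..., n], only the values above [n] compete. *)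
Lemma fseq_after_segment a n : 0 < a -> 1 < n -> iota 1 n =i visited a n ->
  [/\ n < fseq a n.+1, coprime (fseq a n.+1) (fseq a n)
    & forall v, n < v -> coprime v (fseq a n) -> fseq a n.+1 <= v].
Proof.
move=> a0 n1 seg; have [f0 fN fC fmin] := fseq_least_visited a0 n1.
have usedE v : (v \in visited a n) = (0 < v <= n).
  by rewrite -seg mem_iota add1n ltnS.
by split=> [||v nv vC]; rewrite ?usedE in fN *; try lia;
  apply: fmin => //; rewrite ?usedE; lia.
Qed.

Lemma coprime_add2 m : coprime m.+2 m = odd m.
Proof. by rewrite -addn2 /coprime gcdnC gcdnDl -/(coprime m 2) coprimen2. Qed.

(** If [m + k] is the first integer above [m + 1] coprime to [m], every prime
    below [k] divides [m].  A common prime of [m + 2] and [m + k] divides their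
    difference [k - 2], so it would divide [m] and [m + k]. *)
Lemma coprime_gap_bottom m k : 2 < k -> coprime (m + k) m ->
  (forall v, m.+1 < v -> coprime v m -> m + k <= v) -> coprime m.+2 (m + k).
Proof.
move=> k2 kC kmin; rewrite /coprime eqn_leq gcdn_gt0 andbT leqNgt.
apply/negP => /pdivP[q q_pr]; rewrite dvdn_gcd => /andP[q_bot q_top].
have q1 := prime_gt1 q_pr.
have q_k2 : q %| k - 2.
  have -> : k - 2 = m + k - m.+2 by lia.
  exact: dvdn_sub.
have q_lt : q < k by have := dvdn_leq _ q_k2; lia.
have q_m : q %| m.
  rewrite -[_ %| _]negbK -prime_coprime //; apply/negP => q_cop.
  have : m + k <= m + q.
    apply: kmin; first lia.
    by rewrite coprime_sym /coprime gcdnDl -/(coprime m q) coprime_sym.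
  by rewrite leq_add2l leqNgt q_lt.
have : q %| gcdn (m + k) m by rewrite dvdn_gcd q_top.
by rewrite (eqP kC) dvdn1 gtn_eqF.
Qed.

(** Once [1, ..., n] are used and the sequence jumps to [F], every later value
    below [F] is the least unused integer: it succeeds its predecessor, except for
    the first one, whose coprimality to [F] is assumed. *)
Lemma fill_gap a n : 0 < a -> 1 < n -> iota 1 n =i visited a n ->
  coprime n.+1 (fseq a n.+1) ->
  forall j, n.+1 + j <= fseq a n.+1 ->
    (forall v, (v \in visited a (n.+1 + j)) =
               (0 < v <= n + j) || (v == fseq a n.+1))
    /\ (0 < j -> fseq a (n.+1 + j) = n + j).
Proof.
move=> a0 n1 seg cop; elim=> [|j IHj] jF.
  split=> // v; rewrite !addn0 visitedS -seg mem_iota; congr (_ || _); lia.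
have [usedE lastE] := IHj ltac:(lia).
have [f0 fN fC fmin] := @fseq_least_visited a (n.+1 + j) a0 ltac:(lia).
have next : fseq a (n.+1 + j).+1 = n + j.+1.
  have le : fseq a (n.+1 + j).+1 <= n + j.+1.
    apply: fmin; rewrite ?usedE; try lia.
    case: (posnP j) => [->|j0]; first by rewrite addn1 addn0.
    by rewrite lastE // addnS coprimeSn.
  by move: fN; rewrite usedE; lia.
rewrite addnS; split=> // v.
by rewrite visitedS usedE next; lia.
Qed.

Theorem theorem2p1 (a t : nat) (ha : 3 <= a) (ht : ETP a t) :
  is_least (fun u => ETP a u /\ t < u) (fseq a t + 1)
  /\ (forall s : nat, t < s < fseq a t + 1 -> ~ turning_point a s).
Proof.
have a0 : 0 < a by lia.
case: ht => _ [a_lt ft_neq] last_t seg.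
case: t => [|[|m]] in a_lt ft_neq last_t seg *; try lia.
rewrite /= in last_t seg.
have [F_gt F_cop F_min] := @fseq_after_segment a m.+1 a0 ltac:(lia) seg.
rewrite last_t in F_cop F_min.
set F := fseq a m.+2 in ft_neq F_gt F_cop F_min *.
have m_even : ~~ odd m.
  rewrite -coprime_add2; apply/negP => cop.
  have := F_min _ (ltnSn _) cop; lia.
have F_odd : odd F.
  apply/negPn/negP => F_even.
  have : 2 %| gcdn F m by rewrite dvdn_gcd !dvdn2 F_even.
  by rewrite (eqP F_cop).
have bottom : coprime m.+2 F.
  have FE : F = m + (F - m) by lia.
  rewrite FE; apply: coprime_gap_bottom; rewrite -?FE //; lia.
have gap := @fill_gap a m.+1 a0 ltac:(lia) seg bottom.
rewrite -/F in gap.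
have climb s : m.+2 < s <= F -> fseq a s = s.-1.
  move=> s_in; have -> : s = m.+2 + (s - m.+2) by lia.
  have [_ ->] := gap (s - m.+2) ltac:(lia); lia.
have no_turn s : m.+2 < s < F + 1 -> ~ turning_point a s.
  move=> s_in [[_]|[s3 _]]; last lia.
  rewrite climb; last lia.
  (* At [s = t + 1] the sequence descends and the truncated difference is 0. *)
  have [->|s_ne] := eqVneq s m.+3; first by rewrite /= -/F; lia.
  by rewrite climb; lia.
have segF : iota 1 F =i visited a F.
  move=> v; rewrite mem_iota.
  have [+ _] := gap (F - m.+2) ltac:(lia).
  have -> : m.+2 + (F - m.+2) = F by lia.
  by move=> ->; lia.
have lastF : fseq a F = F.-1 by apply: climb; lia.
have [T_gt T_cop _] := @fseq_after_segment a F a0 ltac:(lia) segF.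
(* [F + 1] and the previous value [F - 1] are both even. *)
have T_neq : fseq a F.+1 <> F.+1.
  move=> TE; move: T_cop; rewrite TE lastF => T_cop.
  have : 2 %| gcdn F.+1 F.-1 by rewrite dvdn_gcd !dvdn2; lia.
  by rewrite (eqP T_cop).
split=> //; split.
  rewrite addn1; split; last lia.
  split=> //; last by split=> //; lia.
  by left; rewrite /= lastF; lia.
move=> u [[u_turn _ _ _] t_lt]; rewrite leqNgt; apply/negP => u_lt.
by apply: (no_turn u) u_turn; rewrite t_lt.
Qed.
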